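(* Let $n\ge2$, $x^0\in\mathbb{R}^n$, $d=[\Delta_1,\dots,\Delta_n]^\top$ with all $\Delta_i>0$, $\Delta_{\min}=\min_i\Delta_i$ and $\Delta_S=\|d\|=\sqrt{\sum_{i=1}^n\Delta_i^2}$. Let $f:\operatorname{dom} f\subseteq\mathbb{R}^n\to\mathbb{R}$ be $\mathcal{C}^2$ on an open domain containing $R(x^0;d)$, and let $L_{\nabla f}$ denote the Lipschitz constant of $\nabla f$ on $R(x^0;d)$. For each $(N_1,\dots,N_n)$ with all $N_i\ge 2$, let $S\in\mathbb{R}^{n\times N}$, $N=N_1\cdots N_n$, be a matrix of directions selecting one arbitrary sample point in each cell of the grid on $R(x^0;d)$ (as defined in the context). Then $$\left\|\lim_{\vec N\to\vec\infty}\nabla_sf(x^0;S)-\nabla f(x^0)\right\|\le\frac32\sqrt n\,L_{\nabla f}\,\frac{\Delta_S^2}{\Delta_{\min}}.$$ Moreover, if all $\Delta_i$ are equal, then $$\left\|\lim_{\vec N\to\vec\infty}\nabla_sf(x^0;S)-\nabla f(x^0)\right\|\le\frac12(2n+1)\,L_{\nabla f}\,\Delta_S.$$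
   Context: For $d=[\Delta_1,\dots,\Delta_n]^\top$ with positive entries, $R(x^0;d)=\prod_{i=1}^n[x^0_i,x^0_i+\Delta_i]$. Given integers $N_1,\dots,N_n\ge 2$, put $N=N_1\cdots N_n$, $\overline{\Delta}_i=\Delta_i/N_i$, $\overline D=\operatorname{diag}[\overline\Delta_1,\dots,\overline\Delta_n]$. For $\vec z=(z_2,\dots,z_n)$ with $z_k\in\{1,\dots,N_k\}$, let $B_R^{\vec z}\in\mathbb{R}^{n\times N_1}$ be the matrix whose $j$-th column is $\overline D\,[j,z_2,z_3,\dots,z_n]^\top$, $j=1,\dots,N_1$, and let $B_M^{\vec z}=\overline D\,\ddot B_M^{\vec z}$ where $\ddot B_M^{\vec z}\in\mathbb{R}^{n\times N_1}$ is an arbitrary matrix with all entries in $[0,1]$. Let $B^{\vec z}=B_R^{\vec z}-B_M^{\vec z}$. The matrix $S\in\mathbb{R}^{n\times N}$ is the concatenation of the blocks $B^{\vec z}$ over all $\vec z$, ordered from $(1,\dots,1,1),(1,\dots,1,2),\dots$ to $(N_2,\dots,N_n)$. Thus $S$ depends on $(N_1,\dots,N_n)$ and on the arbitrary choices of $\ddot B_M^{\vec z}$. For a matrix $S\in\mathbb{R}^{n\times N}$ with columns $Se_j$ such that $x^0+Se_j\in\operatorname{dom} f$, the generalized simplex gradient (GSG) is $\nabla_sf(x^0;S)=(S^\dagger)^\top\delta_f(x^0;S)$, where $S^\dagger$ is the Moore--Penrose pseudoinverse and $\delta_f(x^0;S)=[f(x^0+Se_1)-f(x^0),\dots,f(x^0+Se_N)-f(x^0)]^\top\in\mathbb{R}^N$.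 $\lim_{\vec N\to\vec\infty}$ denotes the limit as $N_1\to\infty,\dots,N_n\to\infty$ jointly (each $N_i$ tends to infinity, not necessarily at the same speed). $\|\cdot\|$ is the Euclidean norm. *)

(* Defs.v *)
From HB Require Import structures.
From mathcomp Require Import all_boot all_order all_algebra.
From mathcomp Require Import all_classical all_reals all_analysis.
Set Implicit Arguments.
Unset Strict Implicit.
Unset Printing Implicit Defensive.
Import Order.TTheory GRing.Theory Num.Theory numFieldNormedType.Exports.
Local Open Scope classical_set_scope.
Local Open Scope ring_scope.

(* The library norm `|x| on 'cV[R]_n is the sup norm, so the Euclidean norm is
   defined separately; both induce the same topology. *)
Definition enorm (R : realType) (n : nat) (v : 'cV[R]_n) : R :=
  Num.sqrt (\sum_(i < n) v i 0 ^+ 2).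

Definition box (R : realType) (n : nat) (x0 d : 'cV[R]_n) : set 'cV[R]_n :=
  [set x | forall i, x0 i 0 <= x i 0 <= x0 i 0 + d i 0].

(* The infimum of a nonempty finite set is its minimum. *)
Definition min_entry (R : realType) (n : nat) (d : 'cV[R]_n) : R :=
  inf (range (fun i : 'I_n => d i 0)).

Definition grad (R : realType) (n : nat) (f : 'cV[R]_n -> R)
    (x : 'cV[R]_n) : 'cV[R]_n :=
  \col_i 'D_(delta_mx i 0) f x.

Definition hess (R : realType) (n : nat) (f : 'cV[R]_n -> R)
    (x : 'cV[R]_n) : 'M[R]_n :=
  \matrix_(i, j) 'D_(delta_mx j 0) (fun y => grad f y i 0) x.

Definition C2_on (R : realType) (n : nat) (U : set 'cV[R]_n)
    (f : 'cV[R]_n -> R) : Prop :=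
  forall x, U x ->
    [/\ differentiable f x, differentiable (grad f) x
      & {for x, continuous (hess f)}].

(* The smallest Lipschitz constant with respect to the Euclidean norm; the
   infimum would be the junk value 0 if g were not Lipschitz on A. *)
Definition lipschitz_const (R : realType) (n : nat) (A : set 'cV[R]_n)
    (g : 'cV[R]_n -> 'cV[R]_n) : R :=
  inf [set L : R | 0 <= L /\
    forall x y, A x -> A y -> enorm (g x - g y) <= L * enorm (x - y)].

Definition moore_penrose (R : realType) (m n : nat)
    (A : 'M[R]_(m, n)) (X : 'M[R]_(n, m)) : Prop :=
  [/\ A *m X *m A = A, X *m A *m X = X,
      (A *m X)^T = A *m X & (X *m A)^T = X *m A].

Section MoorePenrose.
Variable R : realType.

Lemma mulmx_trmx_eq0 m n (A : 'M[R]_(m, n)) : A *m A^T = 0 -> A = 0.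
Proof.
move=> AA; apply/matrixP => i j; rewrite [RHS]mxE.
have := congr1 (fun M : 'M[R]_m => M i i) AA; rewrite mxE [RHS]mxE => /eqP.
rewrite psumr_eq0 => [/allP/(_ j)|k _]; last by rewrite mxE -expr2 sqr_ge0.
by rewrite mem_index_enum mxE -expr2 sqrf_eq0 => /(_ isT)/eqP.
Qed.

Lemma row_free_gram_unit m n (A : 'M[R]_(m, n)) :
  row_free A -> A *m A^T \in unitmx.
Proof.
move=> rA; rewrite -row_free_unit -kermx_eq0; apply/eqP.
set K := kermx _; apply: (row_free_inj rA); rewrite mul0mx.
apply: mulmx_trmx_eq0.
by rewrite trmx_mul mulmxA -(mulmxA K) mulmx_ker mul0mx.
Qed.

Lemma moore_penrose_factor m n r (C : 'M[R]_(m, r)) (B : 'M[R]_(r, n)) :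
  row_full C -> row_free B -> exists X, moore_penrose (C *m B) X.
Proof.
move=> fC fB; have uB := row_free_gram_unit fB.
have uC : C^T *m C \in unitmx.
  rewrite -{2}(trmxK C); apply: row_free_gram_unit.
  by rewrite /row_free mxrank_tr.
pose X := B^T *m invmx (B *m B^T) *m (invmx (C^T *m C) *m C^T).
have AX : C *m B *m X = C *m (invmx (C^T *m C) *m C^T).
  by rewrite /X -!mulmxA (mulmxA B) (mulmxA (B *m B^T)) mulmxV // mul1mx.
have XA : X *m (C *m B) = B^T *m invmx (B *m B^T) *m B.
  rewrite /X -!mulmxA (mulmxA C^T) (mulmxA (invmx (C^T *m C))).
  by rewrite mulVmx // mul1mx.
exists X; split.
- rewrite AX -!mulmxA (mulmxA C^T) (mulmxA (invmx (C^T *m C))).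
  by rewrite mulVmx // mul1mx.
- rewrite XA /X -!mulmxA (mulmxA B) (mulmxA (B *m B^T)) mulmxV //.
  by rewrite mul1mx.
- by rewrite AX !trmx_mul trmxK trmx_inv trmx_mul trmxK mulmxA.
- by rewrite XA !trmx_mul trmxK trmx_inv trmx_mul trmxK mulmxA.
Qed.

Lemma moore_penrose_exists m n (A : 'M[R]_(m, n)) :
  exists X, moore_penrose A X.
Proof.
rewrite -(mulmx_base A).
exact: moore_penrose_factor (col_base_full A) (row_base_free A).
Qed.

Lemma moore_penrose_unique m n (A : 'M[R]_(m, n)) X Y :
  moore_penrose A X -> moore_penrose A Y -> X = Y.
Proof.
move=> [AXA XAX sAX sXA] [AYA YAY sAY sYA].
have AXY : A *m X = A *m Y.
  rewrite -sAX -{1}AYA -(mulmxA (A *m Y)) trmx_mul sAX sAY.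
  by rewrite mulmxA AXA.
have XYA : X *m A = Y *m A.
  rewrite -sXA -{1}AYA -(mulmxA A) mulmxA trmx_mul sXA sYA.
  by rewrite -mulmxA (mulmxA A) AXA.
by rewrite -XAX XYA -mulmxA AXY mulmxA YAY.
Qed.

End MoorePenrose.

(* Not to be confused with the library's pinvmx, which is only a one-sided
   generalized inverse. *)
Definition mp_pinv (R : realType) (m n : nat) (A : 'M[R]_(m, n)) :
    'M[R]_(n, m) :=
  xget 0 [set X | moore_penrose A X].

Definition delta_f (R : realType) (n p : nat) (f : 'cV[R]_n -> R)
    (x0 : 'cV[R]_n) (S : 'M[R]_(n, p)) : 'cV[R]_p :=
  \col_j (f (x0 + col j S) - f x0).

Definition gsg (R : realType) (n p : nat) (f : 'cV[R]_n -> R)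
    (x0 : 'cV[R]_n) (S : 'M[R]_(n, p)) : 'cV[R]_n :=
  (mp_pinv S)^T *m delta_f f x0 S.

(* Column k of S belongs to the cell (z_1, ..., z_n): inside a block
   (z_2, ..., z_n) the columns are ordered by z_1, and the blocks are ordered
   lexicographically in (z_2, ..., z_n). So the numbers z_i - 1 are the digits of
   k in the mixed radix system with digits, from the most significant one,
   z_2 - 1, ..., z_n - 1, z_1 - 1; stride N i is the weight of the digit for
   coordinate i. In the code the coordinates are numbered from 0. *)
Definition stride (n : nat) (N : 'I_n -> nat) (i : 'I_n) : nat :=
  (\prod_(m < n | (0 < i) && ((m == 0 :> nat) || (i < m))) N m)%N.

Definition cell_index (n : nat) (N : 'I_n -> nat) (k : nat) (i : 'I_n) : nat :=
  ((k %/ stride N i) %% N i).+1.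

(* Theta concatenates the arbitrary blocks with entries in [0, 1], in the same
   order. *)
Definition sample_mx (R : realType) (n : nat) (d : 'cV[R]_n) (N : 'I_n -> nat)
    (Theta : 'M[R]_(n, \prod_(i < n) N i)) : 'M[R]_(n, \prod_(i < n) N i) :=
  let Dbar := diag_mx (\row_i (d i 0 / (N i)%:R)) in
  let B_R := Dbar *m \matrix_(i, k) (cell_index N k i)%:R in
  let B_M := Dbar *m Theta in
  B_R - B_M.

(* Joint limit N_1, ..., N_n -> oo, with no relation between the speeds. *)
Definition all_infty (n : nat) : set_system ('I_n -> nat) :=
  [set P | exists M : nat, forall N, (forall i, (M <= N i)%N) -> P N].

Arguments all_infty : clear implicits.

#[global] Instance all_infty_proper (n : nat) : ProperFilter (all_infty n).
Proof.
apply: Build_ProperFilter_ex => [P [M MP]|].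
  by exists (fun=> M); apply: MP.
split; first by exists 0%N.
- move=> P Q [M MP] [M' MQ]; exists (maxn M M') => N MN; split.
  + by apply: MP => i; apply: leq_trans (MN i); rewrite leq_maxl.
  + by apply: MQ => i; apply: leq_trans (MN i); rewrite leq_maxr.
- by move=> P Q PQ [M MP]; exists M => N /MP/PQ.
Qed.

(* Main.v *)
Require Import Defs.
From mathcomp Require Import all_boot all_order all_algebra.
From mathcomp Require Import all_classical all_reals all_analysis.
From mathcomp Require Import zify ring lra.
Set Implicit Arguments.
Unset Strict Implicit.
Unset Printing Implicit Defensive.
Import Order.TTheory GRing.Theory Num.Theory numFieldNormedType.Exports.
Local Open Scope classical_set_scope.
Local Open Scope ring_scope.

(** The columns [s_k] of [S] are sample points of the box [0, d], one in each cell
    of the grid, and the GSG is the least squares slope of [f (x0 + s) - f x0]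
    over them: it solves the normal equation [S S^T g = S delta]
    ([gsg_normal_equation]). Divided by the number of cells, both sides are
    Riemann sums. They converge, uniformly in the choice of the points, to the
    moments of the uniform law on the box: [S S^T / N] tends to
    [M = diag d (I / 12 + 1 1^T / 4) diag d] ([second_moment_cvg]), and
    [S delta / N] tends to some [b] ([sample_avg_cvg]). As [M] is coercive, the
    GSG tends to the solution [v] of [M v = b] ([cvg_coercive_system]).

    For the error bound let [e = v - grad f x0]. Since the gradient is Lipschitz,
    the residuals [r_k = f (x0 + s_k) - f x0 - grad f x0 . s_k] are at most
    [rho = L |d|^2 / 2] in absolute value ([taylor_bound]). The average of
    [(e . s_k) r_k] tends to [e^T M e], and by the arithmetic-geometric mean
    inequality it is at most half of the average of [(e . s_k)^2], which also
    tends to [e^T M e], plus [rho^2 / 2]. Hence [e^T M e <= rho^2]. The variance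
    part of [M] gives [e^T M e >= (min d)^2 |e|^2 / 12], and so
    [|e| <= sqrt 3 L |d|^2 / min d]. For [n >= 2] this is below both claimed
    bounds, as [3 <= 9 n / 4], and as [|d|^2 = n (min d)^2] and
    [3 n <= (n + 1 / 2)^2] when all sides of the box are equal.

    The convergence of the Riemann sums rests on [sum_prod_digits], which turns
    the column order of [S] into a product structure, and on [avg_close], which
    compares two grids through the volumes of the intersections of their
    cells. *)

(** * Mixed radix numbering of the cells *)

Definition digit (n : nat) (N : 'I_n -> nat) (k : nat) (i : 'I_n) : nat :=
  ((k %/ stride N i) %% N i)%N.

(** One step of mixed radix decoding: the residue modulo [s * m] is made of the
    residue modulo [s] and of the next digit, taken in base [m]. *)
Lemma eq_mod_of_digits (s m k k' : nat) :
  k = k' %[mod s] -> (k %/ s)%N = (k' %/ s)%N %[mod m] ->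
  k = k' %[mod s * m].
Proof.
move=> eqs eqm.
case: (posnP s) => [s0|s_gt0]; first by rewrite s0 mul0n -s0.
rewrite (divn_eq k s) (divn_eq k' s) eqs.
rewrite (divn_eq (k %/ s) m) (divn_eq (k' %/ s) m) eqm !mulnDl -!mulnA.
by rewrite ![(m * s)%N]mulnC -!addnA !modnMDl.
Qed.

(** The digits are read in the order 0, n - 1, n - 2, ..., 1, so [low_prod N j]
    is the modulus that is known once the digits 0, n - 1, ..., j are. *)
Definition low_prod (n : nat) (N : 'I_n -> nat) (j : nat) : nat :=
  (\prod_(m < n | (m == 0 :> nat) || (j <= m)) N m)%N.

(** Downward induction on [j]: the stride of digit [j] is exactly
    [low_prod N j.+1], so each digit refines the modulus by one more factor. *)
Lemma eq_mod_low_prod (n : nat) (N : 'I_n -> nat) (k k' j : nat) :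
  (0 < j <= n)%N -> (forall i, digit N k i = digit N k' i) ->
  k = k' %[mod low_prod N j].
Proof.
case: n N => [|n] N; first by case: j.
move=> + eqd; elim: {j}(n.+1 - j)%N {-2}j (erefl (n.+1 - j)%N) => [|p IH] j.
  move=> /eqP; rewrite subn_eq0 => nj /andP[_ jn].
  have {nj jn}-> : j = n.+1 by apply/eqP; rewrite eqn_leq jn.
  have -> : low_prod N n.+1 = N ord0.
    rewrite /low_prod (big_pred1 ord0) // => m.
    by rewrite [(n < m)%N]ltnNge -ltnS ltn_ord orbF.
  by have := eqd ord0; rewrite /digit /stride big_pred0_eq !divn1.
move=> eqp /andP[j0 _]; have jn : (j < n.+1)%N by rewrite -subn_gt0 eqp.
pose i := Ordinal jn.
have sE : stride N i = low_prod N j.+1.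
  by apply: eq_bigl => m; rewrite (j0 : 0 < i)%N.
have -> : low_prod N j = (low_prod N j.+1 * N i)%N.
  rewrite /low_prod (bigD1 i) /= ?leqnn ?orbT // mulnC; congr (_ * _)%N.
  apply: eq_bigl => m; rewrite -val_eqE /= [(j < m)%N]ltn_neqAle [m == j :> nat]eq_sym.
  have [m0|m0] := eqVneq (m : nat) 0%N; last by rewrite /= andbC.
  by rewrite m0 (gtn_eqF j0) leqn0 (gtn_eqF j0).
apply: eq_mod_of_digits; last by rewrite -sE; apply: eqd.
by apply: IH => //; lia.
Qed.

Lemma digits_inj (n : nat) (N : 'I_n -> nat) (k k' : 'I_(\prod_(i < n) N i)) :
  (forall i, digit N k i = digit N k' i) -> k = k'.
Proof.
case: n N k k' => [|n] N k k' eqd.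
  case: k k' eqd => k kK [k' kK'] _; apply: val_inj => /=.
  by move: kK kK'; rewrite big_ord0 !ltnS !leqn0 => /eqP-> /eqP->.
have := @eq_mod_low_prod _ N k k' 1 isT eqd.
have -> : low_prod N 1 = \prod_(i < n.+1) N i.
  by apply: eq_bigl => m; rewrite lt0n orbN.
by rewrite !modn_small // => /val_inj.
Qed.

(** The only fact about the column order that the sequel uses: the digits of a
    column number range freely over the product of the intervals [0, N i), so
    a sum of products over the columns is a product of sums. The digit map is
    injective between sets of the same size, hence a reindexing. *)
Lemma sum_prod_digits (R : comNzRingType) (n : nat) (N : 'I_n -> nat)
    (H : 'I_n -> nat -> R) : (forall i, 0 < N i)%N ->
  \sum_(k < \prod_(i < n) N i) \prod_i H i (digit N k i)
    = \prod_i \sum_(a < N i) H i a.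
Proof.
move=> N0; set K := \prod_(i < n) N i.
have NK i : (N i <= K)%N.
  by apply: dvdn_leq; [exact: prodn_gt0|rewrite /K (bigD1 i) //= dvdn_mulr].
have dK (k : 'I_K) i : (digit N k i < K)%N.
  by apply: leq_trans (NK i); rewrite ltn_pmod.
(* All digits are placed in the common type 'I_K, so that the cells form an
   ordinary family of finite functions instead of a dependent product. *)
pose F i := [pred a : 'I_K | (a < N i)%N].
pose phi (k : 'I_K) : {ffun 'I_n -> 'I_K} := [ffun i => Ordinal (dK k i)].
have phi_inj : injective phi.
  move=> k k' /ffunP e; apply: digits_inj => i.
  by have := e i; rewrite !ffunE => /(congr1 val).
have phiE : [set phi k | k : 'I_K]%SET = [set g in family F]%SET.
  apply/eqP; rewrite eqEcard; apply/andP; split.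
    apply/fintype.subsetP => _ /imsetP[k _ ->]; rewrite inE; apply/familyP => i.
    by rewrite ffunE inE ltn_pmod.
  rewrite card_imset // cardsE card_family foldrE big_map big_enum /= card_ord.
  rewrite leq_eqVlt; apply/orP; left; apply/eqP; apply: eq_bigr => i _.
  by rewrite -sum1_card (big_ord_narrow (NK i)) sum1_card card_ord.
transitivity (\sum_(k : 'I_K) \prod_i H i (phi k i)).
  by apply: eq_bigr => k _; apply: eq_bigr => i _; rewrite ffunE.
transitivity (\sum_(g in [set phi k | k : 'I_K]%SET) \prod_i H i (g i)).
  by rewrite big_imset //= => k k' _ _; exact: phi_inj.
rewrite phiE (eq_bigl (fun g => g \in family F)); last by move=> g; rewrite inE.
rewrite -(bigA_distr_big_dep (fun i (a : 'I_K) => (a < N i)%N) (fun i (a : 'I_K) => H i a)).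
by apply: eq_bigr => i _; rewrite (big_ord_narrow (NK i)).
Qed.

(** * Comparison of averages over two grids *)

(** The length of the intersection of the intervals [l, r] and [c, e]. *)
Definition overlap (R : realType) (l r c e : R) : R :=
  Num.max 0 (Num.min r e - Num.max l c).

Lemma overlapC (R : realType) (l r c e : R) : overlap l r c e = overlap c e l r.
Proof. by rewrite /overlap minC maxC [Num.max l c]maxC maxC. Qed.

(** Written with the clamping of a point to [l, r], the overlaps with the
    consecutive intervals of a subdivision telescope. *)
Lemma overlap_clamp (R : realType) (l r c e : R) : l <= r -> c <= e ->
  overlap l r c e = Num.min r (Num.max l e) - Num.min r (Num.max l c).
Proof.
move=> lr ce; rewrite /overlap.
by case: (leP l e); case: (leP l c); case: (leP r e);
  rewrite /Num.max /Num.min; repeat case: ifP; lra.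
Qed.

Lemma sum_overlap (R : realType) (p : nat) (l r : R) :
  (0 < p)%N -> 0 <= l -> l <= r -> r <= 1 ->
  \sum_(b < p) overlap l r (b%:R / p%:R) (b.+1%:R / p%:R) = r - l.
Proof.
move=> p0 l0 lr r1; have p0' : 0 < p%:R :> R by rewrite ltr0n.
pose phi (b : nat) := Num.min r (Num.max l (b%:R / p%:R)).
transitivity (\sum_(0 <= b < p) (phi b.+1 - phi b)).
  rewrite big_mkord; apply: eq_bigr => b _; rewrite overlap_clamp //.
  by rewrite ler_pM2r ?invr_gt0 // ler_nat.
rewrite telescope_sumr // /phi mul0r divff ?gt_eqF //.
rewrite (max_l l0) (min_r lr) max_r; last exact: le_trans r1.
by rewrite min_l.
Qed.

Definition avg (R : realType) (p : nat) (F : 'I_p -> R) : R :=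
  (\sum_(k < p) F k) / p%:R.

Definition cells_meet (R : realType) (n : nat) (N N' : 'I_n -> nat)
    (k k' : nat) : Prop :=
  forall i, (digit N k i)%:R / (N i)%:R < (digit N' k' i).+1%:R / (N' i)%:R :> R
         /\ (digit N' k' i)%:R / (N' i)%:R < (digit N k i).+1%:R / (N i)%:R :> R.

Definition cell_overlap (R : realType) (n : nat) (N N' : 'I_n -> nat)
    (k k' : nat) (i : 'I_n) : R :=
  overlap ((digit N k i)%:R / (N i)%:R) ((digit N k i).+1%:R / (N i)%:R)
    ((digit N' k' i)%:R / (N' i)%:R) ((digit N' k' i).+1%:R / (N' i)%:R).

(** The product of the [cell_overlap]s is the volume of the intersection of a
    cell of one grid of the unit cube with a cell of another; the cells of the
    second grid tile the cube, so these volumes add up to that of the cell. *)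
Lemma sum_cell_overlap (R : realType) (n : nat) (N N' : 'I_n -> nat) (k : nat) :
  (forall i, 0 < N i)%N -> (forall i, 0 < N' i)%N ->
  \sum_(k' < \prod_(i < n) N' i) \prod_i cell_overlap R N N' k k' i
  = (\prod_(i < n) N i)%:R^-1 :> R.
Proof.
move=> N0 N'0; rewrite /cell_overlap.
rewrite (sum_prod_digits (fun i b =>
   overlap ((digit N k i)%:R / (N i)%:R) ((digit N k i).+1%:R / (N i)%:R)
             (b%:R / (N' i)%:R) (b.+1%:R / (N' i)%:R))) // natr_prod -prodfV.
apply: eq_bigr => i _; have Ni0 : 0 < (N i)%:R :> R by rewrite ltr0n.
rewrite sum_overlap //.
- by rewrite -mulrBl -natr1 addrAC subrr add0r mul1r.
- by rewrite ler_pM2r ?invr_gt0 // ler_nat.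
- by rewrite ler_pdivrMr // mul1r ler_nat ltn_pmod.
Qed.

(** Two Riemann sums over different grids are compared without a common
    refinement: the volumes of the intersections of cells couple the two uniform
    weights, and only pairs of cells that meet carry mass. *)
Lemma avg_close (R : realType) (n : nat) (N N' : 'I_n -> nat) (e : R)
    (F : 'I_(\prod_(i < n) N i) -> R) (F' : 'I_(\prod_(i < n) N' i) -> R) :
  (forall i, 0 < N i)%N -> (forall i, 0 < N' i)%N ->
  (forall (k : 'I__) (k' : 'I__), cells_meet R N N' k k' -> `|F k - F' k'| <= e) ->
  `|avg F - avg F'| <= e.
Proof.
move=> N0 N'0 FF'.
pose w (k k' : nat) : R := \prod_i cell_overlap R N N' k k' i.
have wr k : \sum_(k' < \prod_(i < n) N' i) w k k' = (\prod_(i < n) N i)%:R^-1.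
  exact: sum_cell_overlap.
have wc k' : \sum_(k < \prod_(i < n) N i) w k k' = (\prod_(i < n) N' i)%:R^-1.
  rewrite -(sum_cell_overlap R k' N'0 N0); apply: eq_bigr => k _.
  by apply: eq_bigr => i _; rewrite /cell_overlap overlapC.
have -> : avg F = \sum_(k < \prod_(i < n) N i) \sum_(k' < \prod_(i < n) N' i)
      w k k' * F k.
  by rewrite /avg mulr_suml; apply: eq_bigr => k _; rewrite -mulr_suml wr mulrC.
have -> : avg F' = \sum_(k < \prod_(i < n) N i) \sum_(k' < \prod_(i < n) N' i)
      w k k' * F' k'.
  rewrite exchange_big /avg mulr_suml /=; apply: eq_bigr => k' _.
  by rewrite -mulr_suml wc mulrC.
have -> : e = \sum_(k < \prod_(i < n) N i) \sum_(k' < \prod_(i < n) N' i)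
    w k k' * e.
  under eq_bigr do rewrite -mulr_suml wr.
  rewrite sumr_const card_ord -mulrnAl -[_ *+ _]mulr_natr mulVf ?mul1r //.
  by rewrite pnatr_eq0 -lt0n prodn_gt0.
rewrite -sumrB; apply: le_trans (ler_norm_sum _ _ _) _; apply: ler_sum => k _.
rewrite -sumrB; apply: le_trans (ler_norm_sum _ _ _) _; apply: ler_sum => k' _.
have w0 i : 0 <= cell_overlap R N N' k k' i.
  by rewrite /cell_overlap /overlap le_max lexx.
rewrite -mulrBr normrM ger0_norm ?prodr_ge0 //.
have [->|wn0] := eqVneq (w k k') 0; first by rewrite !mul0r.
rewrite ler_wpM2l ?prodr_ge0 //; apply: FF' => i.
have /prodf_neq0/(_ i isT) := wn0.
rewrite /cell_overlap /overlap; set x := _ / _; set y := _ / _; set z := _ / _; set t := _ / _.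
by move=> /eqP; rewrite /Num.max /Num.min; repeat case: ifP; lra.
Qed.

(** * Second moments of the midpoints and convergence along the mesh *)

Lemma avg_dist (R : realType) (p : nat) (F F' : 'I_p -> R) (e : R) :
  0 <= e -> (forall k, `|F k - F' k| <= e) -> `|avg F - avg F'| <= e.
Proof.
move=> e0 FF'; rewrite /avg -mulrBl -sumrB normrM normfV normr_nat.
case: p F F' FF' => [|p] F F' FF'; first by rewrite invr0 mulr0.
rewrite ler_pdivrMr ?ltr0n //; apply: le_trans (ler_norm_sum _ _ _) _.
apply: (@le_trans _ _ (\sum_(k < p.+1) e)); first exact: ler_sum.
by rewrite sumr_const card_ord mulr_natr.
Qed.

Lemma sum_odd (R : comNzRingType) (p : nat) :
  \sum_(a < p) (2 * a%:R + 1) = p%:R ^+ 2 :> R.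
Proof.
elim: p => [|p IH]; first by rewrite big_ord0 expr0n.
by rewrite big_ord_recr /= IH -natr1; ring.
Qed.

Lemma sum_odd_sqr (R : comNzRingType) (p : nat) :
  3 * \sum_(a < p) (2 * a%:R + 1) ^+ 2 = p%:R * (4 * p%:R ^+ 2 - 1) :> R.
Proof.
elim: p => [|p IH]; first by rewrite big_ord0 mulr0 mul0r.
by rewrite big_ord_recr /= mulrDr IH -natr1; ring.
Qed.

(** The midpoint of a cell in coordinate [i], scaled to the unit cube. *)
Definition mid (R : realType) (n : nat) (N : 'I_n -> nat) (k : nat) (i : 'I_n) : R :=
  (2 * (digit N k i)%:R + 1) / (2 * (N i)%:R).

(** Midpoints have mean exactly 1/2 on every grid, so two different coordinates
    are uncorrelated with mean product 1/4; the diagonal is off the second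
    moment 1/3 of the uniform law only by the quadrature error 1/(12 N^2). *)
Lemma avg_mid_mid (R : realType) (n : nat) (N : 'I_n -> nat) (i j : 'I_n) :
  (forall m, 0 < N m)%N ->
  avg (fun k : 'I_(\prod_(m < n) N m) => mid R N k i * mid R N k j)
    = 4^-1 + (i == j)%:R * (12^-1 - (12 * (N i)%:R ^+ 2)^-1).
Proof.
move=> N0; have Nm0 m : (N m)%:R != 0 :> R by rewrite pnatr_eq0 -lt0n.
pose h m (a : nat) : R := (2 * a%:R + 1) / (2 * (N m)%:R).
(* As a product over all coordinates, with factor 1 outside i and j, the summand
   factors along the digits; for i = j both tests pick the same coordinate. *)
pose H m a : R := (if m == i then h m a else 1) * (if m == j then h m a else 1).
have hm m : (\sum_(a < N m) h m a) / (N m)%:R = 2^-1.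
  rewrite /h -mulr_suml sum_odd; have := Nm0 m; move: (N m)%:R => x x0; by field.
have hm2 m : (\sum_(a < N m) h m a ^+ 2) / (N m)%:R
    = 3^-1 - (12 * (N m)%:R ^+ 2)^-1.
  have := sum_odd_sqr R (N m); have := Nm0 m.
  rewrite /h; under [in X in _ -> _ -> X]eq_bigr do rewrite expr_div_n.
  rewrite -mulr_suml; move: (\sum_(_ < _) _) (N m)%:R => s x x0 e.
  have -> : s = 3^-1 * (x * (4 * x ^+ 2 - 1)) by rewrite -e; field.
  by field.
have -> : avg (fun k : 'I_(\prod_(m < n) N m) => mid R N k i * mid R N k j)
    = \prod_m ((\sum_(a < N m) H m a) / (N m)%:R).
  rewrite big_split /= prodfV -natr_prod /avg; congr (_ / _).
  rewrite -sum_prod_digits //; apply: eq_bigr => k _.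
  by rewrite big_split /= -!big_mkcond !big_pred1_eq.
rewrite (bigD1 i) //= {1}/H eqxx.
have Hother m : m != i -> m != j -> (\sum_(a < N m) H m a) / (N m)%:R = 1.
  move=> /negPf mi /negPf mj; rewrite /H mi mj mulr1 sumr_const card_ord.
  by rewrite divff.
have [ij|ij] := eqVneq i j.
  subst j; rewrite [X in _ * X]big1 ?mulr1 => [|m mi]; last exact: Hother.
  rewrite mul1r; under eq_bigr do rewrite -expr2.
  by rewrite hm2; field.
have ji : j != i by rewrite eq_sym.
rewrite (bigD1 j ji) /= {1}/H eqxx (negPf ji).
rewrite [X in _ * (_ * X)]big1 => [|m /andP[mi mj]]; last exact: Hother.
under eq_bigr do rewrite mulr1.
under [X in _ * (X / _ * 1)]eq_bigr do rewrite mul1r.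
by rewrite !hm mul0r; field.
Qed.

(** The gauge of a grid: it bounds the relative size of a cell in every
    direction and tends to 0 along [all_infty]. *)
Definition mesh (R : realType) (n : nat) (N : 'I_n -> nat) : R :=
  \sum_(i < n) (N i)%:R^-1.

Lemma mesh_ge0 (R : realType) (n : nat) (N : 'I_n -> nat) : 0 <= mesh R N.
Proof. by apply: sumr_ge0 => i _; rewrite invr_ge0. Qed.

Lemma le_mesh (R : realType) (n : nat) (N : 'I_n -> nat) (i : 'I_n) :
  (N i)%:R^-1 <= mesh R N.
Proof.
by rewrite /mesh (bigD1 i) //= lerDl sumr_ge0 // => j _; rewrite invr_ge0.
Qed.

Lemma mesh_small (R : realType) (n : nat) (e : R) : 0 < e ->
  exists2 M : nat, (2 <= M)%N &
    forall N : 'I_n -> nat, (forall i, (M <= N i)%N) -> mesh R N <= e.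
Proof.
move=> e0; exists (Num.truncn (n%:R / e)).+2 => // N MN.
set M := (Num.truncn _).+2 in MN.
have M0 : 0 < M%:R :> R by rewrite ltr0n.
apply: (@le_trans _ _ (\sum_(i < n) M%:R^-1)).
  by apply: ler_sum => i _; rewrite lef_pV2 ?posrE ?ltr0n ?ler_nat // (leq_trans _ (MN i)).
rewrite sumr_const card_ord -[_ *+ n]mulr_natl ler_pdivrMr // mulrC -ler_pdivrMr //.
by apply/ltW/(lt_trans (truncnS_gt _)); rewrite ltr_nat.
Qed.

Lemma cvg_mesh (R : realType) (n : nat) (u : ('I_n -> nat) -> R) (l C : R) :
  (forall N, (forall i, 2 <= N i)%N -> `|u N - l| <= C * mesh R N) ->
  u @ all_infty n --> l.
Proof.
move=> ul; apply/cvgrPdist_le => e e0.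
have C0 : 0 < `|C| + 1 by rewrite ltr_wpDl.
have [M M2 MN] := @mesh_small R n (e / (`|C| + 1)) (divr_gt0 e0 C0).
exists M => N NM /=; rewrite distrC.
apply: le_trans (ul _ (fun i => leq_trans M2 (NM i))) _.
apply: (@le_trans _ _ ((`|C| + 1) * mesh R N)).
  by rewrite ler_wpM2r ?mesh_ge0 // (le_trans (ler_norm _)) // lerDl.
by rewrite mulrC -ler_pdivlMr //; apply: MN.
Qed.

Lemma is_cvg_mesh (R : realType) (n : nat) (u : ('I_n -> nat) -> R) (C : R) :
  (forall N N', (forall i, 2 <= N i)%N -> (forall i, 2 <= N' i)%N ->
     `|u N - u N'| <= C * (mesh R N + mesh R N')) ->
  cvg (u @ all_infty n).
Proof.
move=> uu; apply/cauchy_cvgP/cauchy_exP => e e0.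
have C0 : 0 < `|C| + 1 by rewrite ltr_wpDl.
have e'0 : 0 < e / (`|C| + 1) / 4 by rewrite !divr_gt0.
have [M M2 MN] := @mesh_small R n _ e'0.
exists (u (fun=> M)); exists M => N NM /=; rewrite -ball_normE /=.
apply: le_lt_trans (uu _ _ _ (fun i => leq_trans M2 (NM i))) _ => //.
apply: (@le_lt_trans _ _ ((`|C| + 1) * (mesh R (fun=> M) + mesh R N))).
  apply: ler_wpM2r; first by rewrite addr_ge0 ?mesh_ge0.
  by apply: le_trans (ler_norm _) _; rewrite lerDl.
rewrite [ltLHS]mulrC -ltr_pdivlMr //; have := divr_gt0 e0 C0.
have := MN _ NM; have := MN (fun=> M) (fun=> leqnn M); lra.
Qed.

(** * Averages over the sample points *)

Lemma sample_mxE (R : realType) (n : nat) (d : 'cV[R]_n) (N : 'I_n -> nat)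
    (Th : 'M[R]_(n, \prod_(i < n) N i)) i k :
  sample_mx d Th i k = d i 0 * (((digit N k i).+1%:R - Th i k) / (N i)%:R).
Proof.
rewrite /sample_mx !mul_diag_mx !mxE /cell_index -/(digit N k i).
by rewrite -mulrBr -!mulrA [_^-1 * _]mulrC.
Qed.

Lemma sample_in_cell (R : realType) (n : nat) (d : 'cV[R]_n) (N : 'I_n -> nat)
    (Th : 'M[R]_(n, \prod_(i < n) N i)) i k :
  0 < d i 0 -> (0 < N i)%N -> 0 <= Th i k <= 1 ->
  d i 0 * ((digit N k i)%:R / (N i)%:R) <= sample_mx d Th i k
    <= d i 0 * ((digit N k i).+1%:R / (N i)%:R).
Proof.
move=> d0 N0 /andP[t0 t1]; rewrite sample_mxE !ler_pM2l // !ler_pM2r ?invr_gt0 ?ltr0n //.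
by rewrite -natr1; apply/andP; split; lra.
Qed.

Lemma sample_in_box (R : realType) (n : nat) (d : 'cV[R]_n) (N : 'I_n -> nat)
    (Th : 'M[R]_(n, \prod_(i < n) N i)) i k :
  0 < d i 0 -> (0 < N i)%N -> 0 <= Th i k <= 1 ->
  0 <= sample_mx d Th i k <= d i 0.
Proof.
move=> d0 N0 t01; have /andP[h1 h2] := sample_in_cell d0 N0 t01.
have N0' : 0 < (N i)%:R :> R by rewrite ltr0n.
apply/andP; split.
  by apply: le_trans h1; rewrite mulr_ge0 ?divr_ge0 // ltW.
apply: le_trans h2 _; rewrite ger_pMr // ler_pdivrMr // mul1r ler_nat.
by rewrite ltn_pmod.
Qed.

(** Moving each sample point to the midpoint of its own cell costs at most
    [d i (1 / N i + 1 / N j) d j]; the midpoint averages are known exactly. *)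
Lemma second_moment_cvg (R : realType) (n : nat) (d : 'cV[R]_n)
    (Theta : forall N : 'I_n -> nat, 'M[R]_(n, \prod_(i < n) N i)) (i j : 'I_n) :
  (forall i, 0 < d i 0) ->
  (forall N : 'I_n -> nat, (forall i, (2 <= N i)%N) ->
     forall i k, 0 <= Theta N i k <= 1) ->
  (fun N => avg (fun k => sample_mx d (Theta N) i k * sample_mx d (Theta N) j k))
     @ all_infty n --> d i 0 * d j 0 * (4^-1 + (i == j)%:R / 12).
Proof.
move=> d0 Th01; apply: (@cvg_mesh _ _ _ _ (d i 0 * d j 0 * 3)) => N N2.
have N0 m : (0 < N m)%N by exact: ltn_trans (N2 m).
have dd0 : 0 < d i 0 * d j 0 by exact: mulr_gt0.
set t : 'I_n -> 'I_(\prod_(m < n) N m) -> R :=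
  fun m k => ((digit N k m).+1%:R - Theta N m k) / (N m)%:R.
have N0' m : 0 < (N m)%:R :> R by rewrite ltr0n.
have iN0 m : 0 < (N m)%:R^-1 :> R by rewrite invr_gt0.
have -> : avg (fun k => sample_mx d (Theta N) i k * sample_mx d (Theta N) j k)
   = d i 0 * d j 0 * avg (fun k => t i k * t j k).
  rewrite /avg mulrA mulr_sumr; congr (_ / _); apply: eq_bigr => k _.
  by rewrite !sample_mxE mulrACA.
rewrite -mulrBr normrM gtr0_norm // -!mulrA ler_pM2l // ler_pM2l //.
have t01 m k : 0 <= t m k <= 1.
  have /andP[h1 h2] := Th01 N N2 m k; apply/andP; split.
    apply: divr_ge0; last exact: ltW.
    by rewrite -natr1 -addrA addr_ge0 // subr_ge0.
  rewrite ler_pdivrMr // mul1r (@le_trans _ _ (digit N k m).+1%:R) ?gerBl //.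
  by rewrite ler_nat ltn_pmod.
have midE m k : mid R N k m = ((digit N k m)%:R + 2^-1) / (N m)%:R.
  by rewrite /mid; have := N0' m; move: (N m)%:R => x x0; field; rewrite gt_eqF.
have m01 m k : 0 <= mid R N k m <= 1.
  rewrite midE divr_ge0 ?addr_ge0 ?(ltW (N0' m)) ?invr_ge0 //=.
  rewrite ler_pdivrMr // mul1r; apply: (@le_trans _ _ (digit N k m).+1%:R).
    by rewrite -[(digit N k m).+1%:R]natr1; lra.
  by rewrite ler_nat ltn_pmod.
have tm m k : `|t m k - mid R N k m| <= (N m)%:R^-1.
  rewrite midE -mulrBl normrM [`|_^-1|]gtr0_norm // ger_pMl // -natr1.
  by have /andP[h1 h2] := Th01 N N2 m k; rewrite ler_norml; apply/andP; split; lra.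
have avgtm : `|avg (fun k => t i k * t j k)
    - avg (fun k : 'I_(\prod_(m < n) N m) => mid R N k i * mid R N k j)|
    <= (N i)%:R^-1 + (N j)%:R^-1.
  apply: avg_dist => [|k]; first by rewrite addr_ge0 ?ltW.
  have -> : t i k * t j k - mid R N k i * mid R N k j
     = (t i k - mid R N k i) * t j k + mid R N k i * (t j k - mid R N k j) by ring.
  apply: le_trans (ler_normD _ _) _; apply: lerD; rewrite normrM.
    rewrite -[leRHS]mulr1 ler_pM ?normr_ge0 ?tm //.
    by have /andP[? ?] := t01 j k; rewrite ger0_norm.
  rewrite -[leRHS]mul1r ler_pM ?tm //.
  by have /andP[? ?] := m01 i k; rewrite ger0_norm.
rewrite avg_mid_mid // in avgtm.
have := le_mesh R N i; have := le_mesh R N j.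
have N12 : 0 <= ((12 * (N i)%:R ^+ 2)^-1 : R) <= (N i)%:R^-1.
  have x0 := N0' i; have x1 : 1 <= (N i)%:R :> R by rewrite ler1n.
  move: ((N i)%:R : R) x0 x1 => x x0 x1; have x2 : 0 < 12 * x ^+ 2 by rewrite mulr_gt0 ?exprn_gt0.
  apply/andP; split; first by rewrite invr_ge0 ltW.
  by rewrite lef_pV2 ?posrE //; nra.
have : 0 <= ((i == j)%:R : R) <= 1 by case: (i == j); rewrite ?lexx ler01.
move: N12 avgtm; rewrite !ler_norml; move: ((i == j)%:R) => b.
move=> /andP[h1 h2] /andP[h3 h4] /andP[h5 h6] h7 h8.
have : 0 <= b * (12 * (N i)%:R ^+ 2)^-1 <= (N i)%:R^-1.
  apply/andP; split; first exact: mulr_ge0.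
  by apply: le_trans h2; rewrite ler_piMl.
by move=> /andP[h9 h10]; apply/andP; split; move: h3 h4; rewrite mulrBr; lra.
Qed.

(** Riemann sums of a Lipschitz function converge whatever the sample points are:
    points of cells that meet are no further apart than the two cells together
    are wide, so [avg_close] makes the averages a Cauchy family. *)
Lemma sample_avg_cvg (R : realType) (n : nat) (d : 'cV[R]_n) (H : 'cV[R]_n -> R)
    (K : R)
    (Theta : forall N : 'I_n -> nat, 'M[R]_(n, \prod_(i < n) N i)) :
  (forall i, 0 < d i 0) ->
  (forall N : 'I_n -> nat, (forall i, (2 <= N i)%N) ->
     forall i k, 0 <= Theta N i k <= 1) ->
  0 <= K ->
  (forall u v, box 0 d u -> box 0 d v ->
     `|H u - H v| <= K * \sum_i `|u i 0 - v i 0|) ->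
  cvg ((fun N => avg (fun k => H (col k (sample_mx d (Theta N))))) @ all_infty n).
Proof.
move=> d0 Th01 K0 HK; apply: (@is_cvg_mesh _ _ _ (K * \sum_i d i 0)) => N N' N2 N'2.
have N0 m : (0 < N m)%N by exact: ltn_trans (N2 m).
have N'0 m : (0 < N' m)%N by exact: ltn_trans (N'2 m).
have inbox (M : 'I_n -> nat) k : (forall i, 2 <= M i)%N ->
    box 0 d (col k (sample_mx d (Theta M))).
  move=> M2 i; rewrite [col _ _ _ _]mxE [(0 : 'cV_n) i 0]mxE add0r.
  apply: sample_in_box => //; first exact: ltn_trans (M2 i).
  exact: Th01.
apply: avg_close => // k k' kk'.
apply: le_trans (HK _ _ (inbox _ _ N2) (inbox _ _ N'2)) _.
rewrite -mulrA ler_wpM2l // mulr_suml; apply: ler_sum => i _; rewrite ![col _ _ _ _]mxE.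
have /andP[h1 h2] := sample_in_cell (d0 i) (N0 i) (Th01 N N2 i k).
have /andP[h3 h4] := sample_in_cell (d0 i) (N'0 i) (Th01 N' N'2 i k').
apply: (@le_trans _ _ (d i 0 * ((N i)%:R^-1 + (N' i)%:R^-1))); last first.
  by rewrite ler_pM2l // lerD // le_mesh.
have [/ltW c1 /ltW c2] := kk' i.
have := ler_wpM2l (ltW (d0 i)) c1; have := ler_wpM2l (ltW (d0 i)) c2.
move: h1 h2 h3 h4; rewrite -!natr1 !mulrDl !mulrDr !mul1r => h1 h2 h3 h4 h5 h6.
by rewrite ler_norml; apply/andP; split; lra.
Qed.

(** * Differentiation on a box *)

(** The box is the image of a product of segments, which is compact by Tychonoff,
    under transposition of row vectors. *)
Lemma compact_box (R : realType) (n : nat) (x0 d : 'cV[R]_n) : compact (box x0 d).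
Proof.
pose A (i : 'I_n) : set R := `[x0 i 0, x0 i 0 + d i 0]%classic.
have -> : box x0 d = trmx @` [set v : 'rV[R]_n | forall i, A i (v 0 i)].
  apply/seteqP; split => [x xb|_ [v vA <-] i].
    exists x^T; last exact: trmxK.
    by move=> i; rewrite /A /= in_itv /= mxE; exact: xb.
  by have := vA i; rewrite /A /= in_itv /= mxE.
apply: continuous_compact; last first.
  by apply: rV_compact => i; exact: segment_compact.
apply: continuous_subspaceT => x.
apply/(@cvgrPdist_le _ _ _ (nbhs x)) => e e0; apply/nbhs_ballP; exists e => // y.
rewrite -ball_normE /= => /ltW xy; apply: le_trans xy.
rewrite -linearB /= [leLHS]/Num.Def.normr /= mx_normrE; apply: bigmax_le => // -[i j] _.
rewrite mxE [leRHS]/Num.Def.normr /= mx_normrE.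
by apply/bigmax_geP; right; exists (j, i).
Qed.

Lemma bounded_on_box (R : realType) (n : nat) (V : normedModType R)
    (x0 d : 'cV[R]_n) (h : 'cV[R]_n -> V) :
  (forall x, box x0 d x -> {for x, continuous h}) ->
  exists2 B : R, 0 <= B & forall x, box x0 d x -> `|h x| <= B.
Proof.
move=> hc; have : compact (h @` box x0 d).
  apply: continuous_compact (@compact_box R n x0 d).
  by apply/continuous_in_subspaceT => x /[1!inE] /hc.
move=> /compact_bounded [M [_ MP]]; exists (`|M| + 1).
  by rewrite addr_ge0.
by move=> x xb; apply: (MP (`|M| + 1)) => [|//]; rewrite ?ltr_pwDr ?ler_norm //; exists x.
Qed.

Lemma entry_le_norm (R : realType) (m n : nat) (A : 'M[R]_(m, n)) i j :
  `|A i j| <= `|A|.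
Proof.
by rewrite [leRHS]/Num.Def.normr /= mx_normrE; apply/bigmax_geP; right; exists (i, j).
Qed.

Lemma derive_grad (R : realType) (n : nat) (f : 'cV[R]_n -> R) (x v : 'cV[R]_n) :
  differentiable f x -> 'D_v f x = \sum_i grad f x i 0 * v i 0.
Proof.
move=> df; rewrite deriveE // [v in LHS]matrix_sum_delta linear_sum.
apply: eq_bigr => i _; rewrite big_ord1 linearZ /= mxE deriveE //.
by rewrite mulrC.
Qed.

Lemma is_derive_segment (R : realType) (n : nat) (f : 'cV[R]_n -> R)
    (x v : 'cV[R]_n) (t : R) : differentiable f (x + t *: v) ->
  is_derive t 1 (fun t : R => f (x + t *: v))
    (\sum_i grad f (x + t *: v) i 0 * v i 0).
Proof.
move=> df; rewrite -derive_grad //.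
have dg : is_diff t (cst x + (fun t : R => t *: v)) (0 + (fun t : R => t *: v)).
  exact: is_diffD.
have dfg : is_diff t (f \o (cst x + (fun t : R => t *: v)))
    ('d f (x + t *: v) \o (0 + (fun t : R => t *: v))).
  by apply: is_diff_comp; exact: differentiableP.
have dc : differentiable (fun s : R => f (x + s *: v)) t by case: dfg.
apply: DeriveDef; first exact: diff_derivable.
have dE : 'd (fun s : R => f (x + s *: v)) t
    = 'd f (x + t *: v) \o (0 + (fun t : R => t *: v)) :> (R -> R) by case: dfg.
by rewrite deriveE // dE /= deriveE //; congr ('d f _ _); rewrite -[RHS]scale1r -[RHS]add0r.
Qed.

Lemma box_convex (R : realType) (n : nat) (x0 d x y : 'cV[R]_n) (t : R) :
  box x0 d x -> box x0 d y -> 0 <= t <= 1 -> box x0 d (x + t *: (y - x)).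
Proof.
move=> xb yb /andP[t0 t1] i; rewrite !mxE.
have /andP[? ?] := xb i; have /andP[? ?] := yb i.
by apply/andP; split; nra.
Qed.

Lemma mean_value_box (R : realType) (n : nat) (x0 d : 'cV[R]_n)
    (f : 'cV[R]_n -> R) (x y : 'cV[R]_n) :
  (forall x, box x0 d x -> differentiable f x) ->
  box x0 d x -> box x0 d y ->
  exists2 z, box x0 d z & f y - f x = \sum_i grad f z i 0 * (y i 0 - x i 0).
Proof.
move=> df xb yb.
have dF (t : R) : 0 <= t <= 1 -> is_derive t 1 (fun t : R => f (x + t *: (y - x)))
    (\sum_i grad f (x + t *: (y - x)) i 0 * (y - x) i 0).
  by move=> t01; apply/is_derive_segment/df/box_convex.
have [||c + ] := @MVT R (fun t : R => f (x + t *: (y - x)))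
   (fun t : R => \sum_i grad f (x + t *: (y - x)) i 0 * (y - x) i 0) 0 1 ltr01.
- by move=> t; rewrite in_itv /= => /andP[t0 t1]; apply: dF; rewrite !ltW.
- apply: derivable_within_continuous => t; rewrite in_itv /= => t01.
  by have := dF t t01 => -[].
rewrite in_itv /= => /andP[c0 c1]; rewrite scale1r scale0r addr0 subrKC subr0 mulr1 => ->.
exists (x + c *: (y - x)); first by apply: box_convex => //; rewrite !ltW.
by apply: eq_bigr => i _; rewrite !mxE.
Qed.

Lemma lipschitz_of_grad_bound (R : realType) (n : nat) (x0 d : 'cV[R]_n)
    (f : 'cV[R]_n -> R) (B : R) (x y : 'cV[R]_n) :
  (forall x, box x0 d x -> differentiable f x) ->
  (forall x i, box x0 d x -> `|grad f x i 0| <= B) ->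
  box x0 d x -> box x0 d y ->
  `|f x - f y| <= B * \sum_i `|x i 0 - y i 0|.
Proof.
move=> df dB xb yb; have [z zb ->] := mean_value_box df yb xb.
rewrite mulr_sumr; apply: le_trans (ler_norm_sum _ _ _) _.
by apply: ler_sum => i _; rewrite normrM ler_wpM2r // dB.
Qed.

(** * The Lipschitz constant of the gradient and the Taylor remainder *)

Lemma enorm_ge0 (R : realType) (n : nat) (v : 'cV[R]_n) : 0 <= enorm v.
Proof. exact: sqrtr_ge0. Qed.

Lemma enorm_sqr (R : realType) (n : nat) (v : 'cV[R]_n) :
  enorm v ^+ 2 = \sum_i v i 0 ^+ 2.
Proof. by rewrite sqr_sqrtr // sumr_ge0 // => i _; rewrite sqr_ge0. Qed.

Lemma enorm_le (R : realType) (n : nat) (v : 'cV[R]_n) (c : R) :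
  0 <= c -> \sum_i v i 0 ^+ 2 <= c ^+ 2 -> enorm v <= c.
Proof.
by move=> c0; rewrite -enorm_sqr ler_sqr // nnegrE ?enorm_ge0.
Qed.

Lemma enormZ (R : realType) (n : nat) (c : R) (v : 'cV[R]_n) :
  enorm (c *: v) = `|c| * enorm v.
Proof.
rewrite /enorm -sqrtr_sqr -sqrtrM ?sqr_ge0 // mulr_sumr; congr Num.sqrt.
by apply: eq_bigr => i _; rewrite mxE exprMn.
Qed.

Lemma cauchy_schwarz (R : realType) (n : nat) (u v : 'cV[R]_n) :
  \sum_i u i 0 * v i 0 <= enorm u * enorm v.
Proof.
set a := enorm u; set b := enorm v.
have a0 : 0 <= a by exact: enorm_ge0.
have b0 : 0 <= b by exact: enorm_ge0.
have a2 : a ^+ 2 = \sum_i u i 0 ^+ 2 by exact: enorm_sqr.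
have b2 : b ^+ 2 = \sum_i v i 0 ^+ 2 by exact: enorm_sqr.
have key : 0 <= \sum_i (b * u i 0 - a * v i 0) ^+ 2.
  by apply: sumr_ge0 => i _; exact: sqr_ge0.
have keyE : \sum_i (b * u i 0 - a * v i 0) ^+ 2
    = 2 * (a * b) * (a * b - \sum_i u i 0 * v i 0).
  have -> : 2 * (a * b) * (a * b - \sum_i u i 0 * v i 0)
    = b ^+ 2 * a ^+ 2 + a ^+ 2 * b ^+ 2 - 2 * (a * b) * \sum_i u i 0 * v i 0 by ring.
  rewrite {1}a2 {2}b2 !mulr_sumr -big_split -sumrB /=.
  by apply: eq_bigr => i _; ring.
rewrite keyE in key.
have [ab0|ab0] := ltP 0 (a * b).
  by rewrite -subr_ge0; move: key; rewrite pmulr_rge0 // mulr_gt0.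
have /eqP : a * b = 0 by apply/le_anti; rewrite ab0 mulr_ge0.
rewrite mulf_eq0 => /orP[] /eqP z0.
  rewrite big1 ?mulr_ge0 // => i _.
  have /eqP := a2; rewrite z0 expr0n /= eq_sym psumr_eq0 => [/allP/(_ i)|j _]; last exact: sqr_ge0.
  by rewrite mem_index_enum sqrf_eq0 => /(_ isT)/eqP->; rewrite mul0r.
rewrite big1 ?mulr_ge0 // => i _.
have /eqP := b2; rewrite z0 expr0n /= eq_sym psumr_eq0 => [/allP/(_ i)|j _]; last exact: sqr_ge0.
by rewrite mem_index_enum sqrf_eq0 => /(_ isT)/eqP->; rewrite mulr0.
Qed.

Lemma abs_entry_le_enorm (R : realType) (n : nat) (v : 'cV[R]_n) i :
  `|v i 0| <= enorm v.
Proof.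
rewrite -ler_sqr ?nnegrE ?enorm_ge0 // enorm_sqr real_normK ?num_real //.
by rewrite (bigD1 i) //= lerDl sumr_ge0 // => j _; rewrite sqr_ge0.
Qed.

Lemma enorm_le_const (R : realType) (n : nat) (v : 'cV[R]_n) (c : R) :
  0 <= c -> (forall i, `|v i 0| <= c) -> enorm v <= n%:R * c.
Proof.
move=> c0 vc; case: n v vc => [|n] v vc.
  by apply: enorm_le; rewrite ?big_ord0 ?mul0r ?sqr_ge0.
apply: enorm_le; first exact: mulr_ge0.
apply: (@le_trans _ _ (\sum_(i < n.+1) c ^+ 2)).
  apply: ler_sum => i _; rewrite -[leLHS]real_normK ?num_real //.
  by rewrite ler_sqr ?nnegrE.
rewrite sumr_const card_ord -[_ *+ n.+1]mulr_natl exprMn ler_wpM2r ?sqr_ge0 //.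
by rewrite expr2 ler_peMl // ler1n.
Qed.

Lemma lipschitz_const_ge0 (R : realType) (n : nat) (A : set 'cV[R]_n)
    (g : 'cV[R]_n -> 'cV[R]_n) : 0 <= lipschitz_const A g.
Proof.
rewrite /lipschitz_const; set E := [set L | _].
have [->|/set0P E0] := eqVneq E set0; first by rewrite inf0.
by apply: lb_le_inf => // L [].
Qed.

(** The infimum that defines [lipschitz_const] is attained as soon as some
    Lipschitz constant [K] exists: each ratio is a lower bound of the set. *)
Lemma lipschitz_constP (R : realType) (n : nat) (A : set 'cV[R]_n)
    (g : 'cV[R]_n -> 'cV[R]_n) (K : R) (x y : 'cV[R]_n) :
  0 <= K -> (forall x y, A x -> A y -> enorm (g x - g y) <= K * enorm (x - y)) ->
  A x -> A y -> enorm (g x - g y) <= lipschitz_const A g * enorm (x - y).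
Proof.
move=> K0 gK xA yA; have [xy0|xy0] := ltP 0 (enorm (x - y)).
  rewrite -ler_pdivrMr //; apply: lb_le_inf; first by exists K.
  by move=> L [L0 gL]; rewrite ler_pdivrMr // gL.
have e0 : enorm (x - y) = 0 by apply/le_anti; rewrite xy0 enorm_ge0.
by have := gK _ _ xA yA; rewrite e0 !mulr0.
Qed.

(** The Hessian is bounded on the compact box, and the rows of the Hessian are
    the gradients of the components of [grad f]; the mean value theorem on the
    convex box yields a finite Lipschitz constant. *)
Lemma C2_grad_lipschitz (R : realType) (n : nat) (x0 d : 'cV[R]_n)
    (U : set 'cV[R]_n) (f : 'cV[R]_n -> R) (x y : 'cV[R]_n) :
  box x0 d `<=` U -> C2_on U f -> box x0 d x -> box x0 d y ->
  enorm (grad f x - grad f y)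
    <= lipschitz_const (box x0 d) (grad f) * enorm (x - y).
Proof.
move=> bU fC2.
have [B B0 hB] : exists2 B : R, 0 <= B & forall x, box x0 d x -> `|hess f x| <= B.
  by apply: bounded_on_box => z /bU /fC2 [].
apply: (@lipschitz_constP _ _ _ _ (n%:R * (B * n%:R))).
  by rewrite !mulr_ge0.
move=> {}x {}y xb yb; rewrite -mulrA.
apply: enorm_le_const; first by rewrite !mulr_ge0 // enorm_ge0.
move=> i; rewrite !mxE.
have dgi z : box x0 d z -> differentiable (fun y => grad f y i 0) z.
  move=> /bU /fC2 [_ dg _].
  apply: (@differentiable_comp _ _ _ _ (grad f) (fun v => v i 0)) => //.
  exact: differentiable_coord.
have := @lipschitz_of_grad_bound _ _ x0 d (fun y => grad f y i 0) B x y dgi.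
rewrite !mxE => /(_ _ xb yb) h; apply: le_trans (h _) _.
  move=> z j zb; apply: le_trans (hB z zb).
  by have := entry_le_norm (hess f z) i j; rewrite !mxE.
rewrite -mulrA ler_wpM2l //.
apply: (@le_trans _ _ (\sum_(i < n) enorm (x - y))).
  by apply: ler_sum => j _; have := abs_entry_le_enorm (x - y) j; rewrite !mxE.
by rewrite sumr_const card_ord mulr_natl.
Qed.

(** The sharp factor [L / 2] is obtained from a single mean value step, applied to
    [s (f (x0 + t u) - t a) - (L / 2) |u|^2 t^2], whose derivative is nonpositive
    on [0, 1]; the sign [s] gives the two sides of the bound. *)
Lemma taylor_bound (R : realType) (n : nat) (x0 d : 'cV[R]_n)
    (f : 'cV[R]_n -> R) (L : R) (u : 'cV[R]_n) :
  (forall x, box x0 d x -> differentiable f x) ->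
  (forall x y, box x0 d x -> box x0 d y ->
     enorm (grad f x - grad f y) <= L * enorm (x - y)) ->
  box x0 d x0 -> box x0 d (x0 + u) ->
  `|f (x0 + u) - f x0 - \sum_i grad f x0 i 0 * u i 0| <= L / 2 * enorm u ^+ 2.
Proof.
move=> df gL x0b ub.
set a := \sum_i grad f x0 i 0 * u i 0; set b := enorm u ^+ 2.
have seg (t : R) : 0 <= t <= 1 -> box x0 d (x0 + t *: u).
  by move=> t01; have := box_convex x0b ub t01; rewrite [x0 + u]addrC addrK.
suff bound (s : R) : s ^+ 2 = 1 -> s * (f (x0 + u) - f x0 - a) <= L / 2 * b.
  rewrite ler_norml; apply/andP; split.
    by have := bound (-1); rewrite sqrrN expr1n mulN1r lerNl => /(_ erefl).
  by have := bound 1; rewrite expr1n mul1r => /(_ erefl).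
move=> s2.
pose F' (t : R) := \sum_i grad f (x0 + t *: u) i 0 * u i 0.
pose phi := (fun t : R => s * (f (x0 + t *: u) - t * a) - L / 2 * b * t ^+ 2).
pose phi' (t : R) := s * (F' t - a) - L * b * t.
have dphi (t : R) : 0 <= t <= 1 -> is_derive t 1 phi (phi' t).
  move=> /seg/df/is_derive_segment dF.
  have -> : phi = (s \*: ((fun t : R => f (x0 + t *: u)) - (a \*: id)))
      - ((L / 2 * b) \*: (id ^+ 2)).
    by apply/funext => r; rewrite /phi; congr (_ - _); congr (s * (_ - _)); rewrite mulrC.
  apply: is_derive_eq.
  rewrite /phi' /F' expr1 /GRing.scale /=; move: (\sum_i _) => q.
  by field.
have [||c + ] := @MVT R phi phi' 0 1 ltr01.
- by move=> t; rewrite in_itv /= => /andP[t0 t1]; apply: dphi; rewrite !ltW.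
- apply: derivable_within_continuous => t; rewrite in_itv /= => t01.
  by have := dphi t t01 => -[].
rewrite in_itv /= => /andP[c0 c1].
have cle : phi' c <= 0.
  rewrite /phi' subr_le0.
  have -> : s * (F' c - a)
      = \sum_i (s *: (grad f (x0 + c *: u) - grad f x0)) i 0 * u i 0.
    rewrite /F' -sumrB mulr_sumr; apply: eq_bigr => i _.
    by rewrite !mxE; ring.
  apply: le_trans (cauchy_schwarz _ _) _.
  rewrite enormZ -sqrtr_sqr s2 sqrtr1 mul1r.
  have -> : L * b * c = L * (c * enorm u) * enorm u by rewrite /b; ring.
  apply: ler_wpM2r; first exact: enorm_ge0.
  apply: le_trans (gL _ _ (seg c _) x0b) _; first by rewrite !ltW.
  by rewrite addrAC subrr add0r enormZ gtr0_norm.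
rewrite /phi scale1r scale0r addr0 subr0 mulr1 => e; move: e cle => <-.
rewrite mul1r mul0r subr0 expr1n expr0n /= mulr1 mulr0 subr0; lra.
Qed.

(** * The normal equation and convergence of coercive systems *)

(** By two of the Penrose conditions,
    [S S^T (S^+)^T = S (S^+ S)^T = S S^+ S = S]. *)
Lemma gsg_normal_equation (R : realType) (n p : nat) (f : 'cV[R]_n -> R)
    (x0 : 'cV[R]_n) (S : 'M[R]_(n, p)) :
  S *m S^T *m gsg f x0 S = S *m delta_f f x0 S.
Proof.
have [X SX] := moore_penrose_exists S.
have [SXS _ _ XS] : moore_penrose S (mp_pinv S) by apply: xgetPex; exists X.
by rewrite /gsg -!mulmxA (mulmxA S^T) -trmx_mul XS !mulmxA SXS.
Qed.

Lemma avg_normal_equation (R : realType) (n p : nat) (f : 'cV[R]_n -> R)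
    (x0 : 'cV[R]_n) (S : 'M[R]_(n, p)) (i : 'I_n) :
  \sum_j avg (fun k => S i k * S j k) * gsg f x0 S j 0
    = avg (fun k => S i k * (f (x0 + col k S) - f x0)).
Proof.
have := congr1 (fun A : 'cV_n => A i 0) (gsg_normal_equation f x0 S).
rewrite mxE [RHS]mxE => e; rewrite /avg.
have -> : \sum_k S i k * (f (x0 + col k S) - f x0)
    = \sum_k S i k * delta_f f x0 S k 0.
  by apply: eq_bigr => k _; rewrite [delta_f _ _ _ _ _]mxE.
rewrite -e mulr_suml; apply: eq_bigr => j _.
rewrite mulrAC; congr (_ * _ / _); rewrite mxE.
by apply: eq_bigr => k _; rewrite [S^T _ _]mxE.
Qed.

Lemma cvg_sum_ord (R : realType) (T : Type) (F : set_system T) (n : nat)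
    (u : 'I_n -> T -> R) (l : 'I_n -> R) : Filter F ->
  (forall i, u i x @[x --> F] --> l i) ->
  \sum_i u i x @[x --> F] --> \sum_i l i.
Proof.
by move=> FF ul; apply: cvg_big => //; exact: add_continuous.
Qed.

(** Solutions of linear systems converge when the coefficients do and the limit
    matrix is coercive. With [w = g x - v0], [w^T A0 w] is the pairing of [w]
    with the residual [b x - A x v0], which tends to 0, plus a term in
    [A0 - A x], which coercivity absorbs. *)
Lemma cvg_coercive_system (R : realType) (T : Type) (F : set_system T) (n : nat)
    (A : 'I_n -> 'I_n -> T -> R) (b : 'I_n -> T -> R) (g : T -> 'cV[R]_n)
    (A0 : 'I_n -> 'I_n -> R) (v0 : 'cV[R]_n) (c : R) : Filter F ->
  (\forall x \near F, forall i, \sum_j A i j x * g x j 0 = b i x) ->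
  (forall i j, A i j x @[x --> F] --> A0 i j) ->
  (forall i, b i x @[x --> F] --> \sum_j A0 i j * v0 j 0) ->
  0 < c ->
  (forall v : 'cV[R]_n, c * enorm v ^+ 2 <= \sum_i \sum_j v i 0 * A0 i j * v j 0) ->
  g x @[x --> F] --> v0.
Proof.
move=> FF Agb AA0 bb0 c0 coer; apply/cvgrPdist_le => e e0.
have n0 : 0 < n%:R + 1 :> R by rewrite ltr_wpDl.
(* eta is small enough for the n^2 perturbed entries to use up only half of the
   coercivity constant; de makes the residual smaller than the other half. *)
pose eta := c / 2 / (n%:R + 1) ^+ 2; pose de := c / 2 * e / (n%:R + 1).
have eta0 : 0 < eta by rewrite !divr_gt0 ?exprn_gt0.
have de0 : 0 < de by rewrite divr_gt0 // mulr_gt0 // divr_gt0.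
have resid i : b i x - \sum_j A i j x * v0 j 0 @[x --> F] --> (0 : R).
  rewrite -[X in _ --> X](subrr (\sum_j A0 i j * v0 j 0)).
  apply: cvgB => //; apply: cvg_sum_ord => j.
  by apply: cvgMr_tmp.
have Anear : \forall x \near F, forall i j, `|A0 i j - A i j x| <= eta.
  apply: filter_forall => i; apply: filter_forall => j.
  by have /cvgrPdist_le/(_ _ eta0) := AA0 i j.
have rnear : \forall x \near F, forall i, `|0 - (b i x - \sum_j A i j x * v0 j 0)| <= de.
  apply: filter_forall => i.
  by have /cvgrPdist_le/(_ _ de0) := resid i.
near=> x.
have Ax : forall i j, `|A0 i j - A i j x| <= eta by near: x.
have rx : forall i, `|0 - (b i x - \sum_j A i j x * v0 j 0)| <= de by near: x.
have gx : forall i, \sum_j A i j x * g x j 0 = b i x by near: x.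
pose v := g x - v0; pose r : 'cV[R]_n := \col_i (b i x - \sum_j A i j x * v0 j 0).
have rE i : \sum_j A i j x * v j 0 = r i 0.
  rewrite mxE -gx -sumrB; apply: eq_bigr => j _.
  by rewrite !mxE mulrBr.
have rle : enorm r <= n%:R * de.
  apply: enorm_le_const; first exact: ltW.
  by move=> i; have := rx i; rewrite sub0r normrN mxE.
have Dle : \sum_i \sum_j v i 0 * (A0 i j - A i j x) * v j 0
    <= n%:R ^+ 2 * eta * enorm v ^+ 2.
  have -> : n%:R ^+ 2 * eta * enorm v ^+ 2 = \sum_(i < n) \sum_(j < n) eta * enorm v ^+ 2.
    by rewrite !sumr_const !card_ord -!mulrnA -[RHS]mulr_natl natrM -!mulrA.
  apply: ler_sum => i _; apply: ler_sum => j _.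
  apply: le_trans (ler_norm _) _; rewrite !normrM mulrAC mulrC expr2.
  by do ?apply: ler_pM => //; rewrite ?mulr_ge0 ?abs_entry_le_enorm.
have main : c * enorm v ^+ 2 <= enorm v * enorm r + n%:R ^+ 2 * eta * enorm v ^+ 2.
  apply: le_trans (coer v) _.
  apply: le_trans (lerD (cauchy_schwarz v r) Dle).
  rewrite -big_split /= ler_sum // => i _.
  rewrite -rE mulr_sumr -big_split /= ler_sum // => j _.
  by rewrite le_eqVlt; apply/orP; left; apply/eqP; ring.
have ev : enorm v <= e.
  have v0' := enorm_ge0 v.
  have etaE : n%:R ^+ 2 * eta <= c / 2.
    rewrite /eta mulrCA ger_pMr ?divr_gt0 // ler_pdivrMr ?exprn_gt0 // mul1r.
    by rewrite ler_sqr ?nnegrE ?lerDl // ltW.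
  have deE : n%:R * de <= c / 2 * e.
    rewrite /de mulrCA ger_pMr ?mulr_gt0 ?divr_gt0 // ler_pdivrMr // mul1r.
    by rewrite lerDl.
  have [//|ev] := leP (enorm v) e.
  have vpos : 0 < enorm v by exact: lt_trans ev.
  have : c / 2 * enorm v ^+ 2 <= enorm v * (c / 2 * e).
    have := ler_wpM2l v0' (le_trans rle deE).
    have := ler_wpM2r (sqr_ge0 (enorm v)) etaE; lra.
  by rewrite expr2 mulrCA ler_pM2l // ler_pM2l ?divr_gt0 // leNgt ev.
rewrite distrC -/v; apply: le_trans ev.
rewrite [leLHS]/Num.Def.normr /= mx_normrE; apply: bigmax_le => [|[i j] _] /=.
  exact: enorm_ge0.
by rewrite ord1 abs_entry_le_enorm.
Unshelve. all: by end_near. Qed.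

(** * The limit quadratic form and the residuals *)

(** A coercive matrix has a trivial kernel, hence it is invertible. *)
Lemma coercive_solvable (R : realType) (n : nat) (A : 'I_n -> 'I_n -> R) (c : R)
    (b : 'I_n -> R) : 0 < c ->
  (forall v : 'cV[R]_n, c * enorm v ^+ 2 <= \sum_i \sum_j v i 0 * A i j * v j 0) ->
  exists v : 'cV[R]_n, forall i, \sum_j A i j * v j 0 = b i.
Proof.
move=> c0 coer; pose M : 'M[R]_n := \matrix_(i, j) A i j.
have uM : M \in unitmx.
  rewrite -row_free_unit -kermx_eq0; apply/eqP/row_matrixP => i; rewrite row0.
  have : row i (kermx M) *m M = 0 by rewrite -row_mul mulmx_ker row0.
  move: (row i _) => w wM; apply/rowP => k; rewrite [RHS]mxE.
  have : c * enorm w^T ^+ 2 <= 0.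
    apply: le_trans (coer w^T) _; rewrite exchange_big /= big1 // => j _.
    rewrite -mulr_suml.
    have /(congr1 (fun x : 'rV_n => x 0 j)) := wM; rewrite mxE [RHS]mxE => e.
    suff -> : \sum_i w^T i 0 * A i j = 0 by rewrite mul0r.
    by rewrite -[RHS]e; apply: eq_bigr => m _; rewrite !mxE.
  rewrite pmulr_rle0 // => w0.
  have := abs_entry_le_enorm w^T k; rewrite mxE.
  have -> : enorm w^T = 0.
    by apply/eqP; rewrite -sqrf_eq0 eq_le w0 sqr_ge0.
  by rewrite normr_le0 => /eqP.
exists (invmx M *m \col_i b i) => i.
have := congr1 (fun x : 'cV_n => x i 0) (mulKVmx uM (\col_i b i)).
rewrite /= [RHS]mxE => <-; rewrite [RHS]mxE.
by apply: eq_bigr => j _; rewrite [M _ _]mxE.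
Qed.

(** The limit of [S S^T / N] is the second moment matrix of the uniform law on
    the box [0, d]. Its quadratic form is mean square plus variance, and the
    variances alone, [d_i^2 / 12], make it coercive. *)
Lemma uniform_moment_form (R : realType) (n : nat) (d v : 'cV[R]_n) :
  \sum_i \sum_j v i 0 * (d i 0 * d j 0 * (4^-1 + (i == j)%:R / 12)) * v j 0
  = (\sum_i d i 0 * v i 0) ^+ 2 / 4 + (\sum_i (d i 0 * v i 0) ^+ 2) / 12.
Proof.
rewrite expr2 mulr_suml !mulr_suml -big_split /=; apply: eq_bigr => i _.
rewrite mulr_sumr mulr_suml.
under eq_bigr => j _.
  have -> : v i 0 * (d i 0 * d j 0 * (4^-1 + (i == j)%:R / 12)) * v j 0
    = d i 0 * v i 0 * (d j 0 * v j 0) / 4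
      + (if j == i then (d i 0 * v i 0) * (d j 0 * v j 0) / 12 else 0).
    by rewrite eq_sym; case: (j == i) => /=; field.
  over.
by rewrite big_split /= -big_mkcond big_pred1_eq.
Qed.

Lemma min_entryP (R : realType) (n : nat) (d : 'cV[R]_n) : (0 < n)%N ->
  exists2 i, min_entry d = d i 0 & forall j, d i 0 <= d j 0.
Proof.
case: n d => // n d _.
have [i _ imin] := @Order.TotalTheory.arg_minP _ _ _ (ord0 : 'I_n.+1) predT (fun i => d i 0) isT.
exists i; last by move=> j; exact: imin.
apply/le_anti/andP; split.
  apply: ge_inf; last by exists i.
  by exists (d i 0) => _ [j _ <-]; exact: imin.
apply: lb_le_inf; first by exists (d i 0); exists i.
by move=> _ [j _ <-]; exact: imin.
Qed.

(** With the residuals [r_k = f (x0 + s_k) - f x0 - g . s_k], the left side is the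
    average of [(v . s_k) r_k], and [a r <= a^2 / 2 + r^2 / 2]. *)
Lemma avg_residual_le (R : realType) (n p : nat) (f : 'cV[R]_n -> R)
    (x0 g v : 'cV[R]_n) (S : 'M[R]_(n, p)) (rho : R) :
  (forall k, `|f (x0 + col k S) - f x0 - \sum_i g i 0 * S i k| <= rho) ->
  \sum_i v i 0 * (avg (fun k => S i k * (f (x0 + col k S) - f x0))
                  - \sum_j avg (fun k => S i k * S j k) * g j 0)
    <= (\sum_i \sum_j v i 0 * avg (fun k => S i k * S j k) * v j 0) / 2
       + rho ^+ 2 / 2.
Proof.
move=> frho.
pose r k := f (x0 + col k S) - f x0 - \sum_i g i 0 * S i k.
pose s k := \sum_i v i 0 * S i k.
have -> : \sum_i v i 0 * (avg (fun k => S i k * (f (x0 + col k S) - f x0))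
                  - \sum_j avg (fun k => S i k * S j k) * g j 0)
    = avg (fun k => s k * r k).
  rewrite /avg mulr_suml /s /r.
  under [RHS]eq_bigr do rewrite mulr_suml mulr_suml.
  rewrite exchange_big /=; apply: eq_bigr => i _.
  under [X in _ - X]eq_bigr do rewrite mulrAC.
  rewrite -mulr_suml -mulrBl mulrA -!mulr_suml; congr (_ / _).
  rewrite mulrBr mulr_sumr.
  have -> : \sum_j (\sum_k S i k * S j k) * g j 0
     = \sum_k S i k * (\sum_j g j 0 * S j k).
    under eq_bigr do rewrite mulr_suml.
    rewrite exchange_big /=; apply: eq_bigr => k _; rewrite mulr_sumr.
    by apply: eq_bigr => j _; ring.
  by rewrite mulr_sumr -sumrB; apply: eq_bigr => k _; ring.
have -> : \sum_i \sum_j v i 0 * avg (fun k => S i k * S j k) * v j 0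
    = avg (fun k => s k ^+ 2).
  rewrite /avg /s.
  under [X in _ = X / _]eq_bigr do rewrite expr2 mulr_suml.
  rewrite [X in _ = X / _]exchange_big /= mulr_suml; apply: eq_bigr => i _.
  under [X in _ = X / _]eq_bigr do rewrite mulr_sumr.
  rewrite [X in _ = X / _]exchange_big /= mulr_suml; apply: eq_bigr => j _.
  rewrite mulrA mulrAC; congr (_ / _).
  by rewrite mulr_sumr mulr_suml; apply: eq_bigr => k _; ring.
rewrite /avg; have [p0|p0] := posnP p.
  by subst p; rewrite !big_ord0 !mul0r add0r divr_ge0 // sqr_ge0.
rewrite ler_pdivrMr ?ltr0n // mulrDl [X in _ <= X + _]mulrAC divfK ?pnatr_eq0 -?lt0n //.
have -> : rho ^+ 2 / 2 * p%:R = \sum_(k < p) rho ^+ 2 / 2.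
  by rewrite sumr_const card_ord mulr_natr.
rewrite mulr_suml -big_split /=; apply: ler_sum => k _.
have r2 : r k ^+ 2 <= rho ^+ 2.
  rewrite -[leLHS]real_normK ?num_real //.
  rewrite ler_sqr ?nnegrE //; first exact: frho.
  exact: le_trans (normr_ge0 _) (frho k).
have := sqr_ge0 (s k - r k); nra.
Qed.

Lemma first_moment_lipschitz (R : realType) (n : nat) (x0 d : 'cV[R]_n)
    (f : 'cV[R]_n -> R) (B : R) (i : 'I_n) (u v : 'cV[R]_n) :
  (forall i, 0 < d i 0) -> 0 <= B ->
  (forall x, box x0 d x -> differentiable f x) ->
  (forall x i, box x0 d x -> `|grad f x i 0| <= B) ->
  box 0 d u -> box 0 d v ->
  `|u i 0 * (f (x0 + u) - f x0) - v i 0 * (f (x0 + v) - f x0)|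
    <= 2 * B * (\sum_j d j 0) * \sum_j `|u j 0 - v j 0|.
Proof.
move=> d0 B0 df dB ub vb.
have shift w : box 0 d w -> box x0 d (x0 + w).
  move=> wb j; have := wb j; rewrite !mxE !add0r => /andP[? ?].
  by rewrite lerDl lerD2l; apply/andP.
have x0b : box x0 d x0 by move=> j; rewrite lexx lerDl ltW.
have sumd0 : 0 <= \sum_j d j 0 by apply: sumr_ge0 => j _; exact: ltW.
have sum0 : 0 <= \sum_j `|u j 0 - v j 0| by exact: sumr_ge0.
have -> : u i 0 * (f (x0 + u) - f x0) - v i 0 * (f (x0 + v) - f x0)
   = (u i 0 - v i 0) * (f (x0 + u) - f x0) + v i 0 * (f (x0 + u) - f (x0 + v)) by ring.
have -> : 2 * B * (\sum_j d j 0) * \sum_j `|u j 0 - v j 0|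
   = (\sum_j `|u j 0 - v j 0|) * (B * \sum_j d j 0)
     + (\sum_j d j 0) * (B * \sum_j `|u j 0 - v j 0|) by ring.
apply: le_trans (ler_normD _ _) _; rewrite !normrM; apply: lerD; apply: ler_pM => //.
- by rewrite [leRHS](bigD1 i) //= lerDl sumr_ge0.
- apply: le_trans (lipschitz_of_grad_bound df dB (shift _ ub) x0b) _.
  rewrite ler_wpM2l // ler_sum // => j _; rewrite !mxE addrAC subrr add0r.
  by have := ub j; rewrite !mxE add0r => /andP[? ?]; rewrite ger0_norm.
- have := vb i; rewrite !mxE add0r => /andP[vi0 vid]; rewrite ger0_norm //.
  apply: le_trans vid _; rewrite (bigD1 i) //= lerDl sumr_ge0 // => j _.
  exact: ltW.
- apply: le_trans (lipschitz_of_grad_bound df dB (shift _ ub) (shift _ vb)) _.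
  rewrite ler_wpM2l // ler_sum // => j _; rewrite !mxE.
  by rewrite opprD addrACA subrr add0r.
Qed.

(** * The limit of the generalized simplex gradient *)

(** The limit [v] solves [M v = b], where [M] is the second moment matrix and [b]
    the limit of the averages of [s (f (x0 + s) - f x0)]. The error
    [e = v - grad f x0] satisfies [e^T M e <= e^T M e / 2 + rho^2 / 2], with
    [rho] the Taylor bound on the box, by passing to the limit in
    [avg_residual_le]; the variance part of [M] gives the stated bound. *)
Lemma gsg_cvg_energy (R : realType) (n : nat) (x0 d : 'cV[R]_n)
    (U : set 'cV[R]_n) (f : 'cV[R]_n -> R)
    (Theta : forall N : 'I_n -> nat, 'M[R]_(n, \prod_(i < n) N i)) :
  (0 < n)%N ->
  (forall i, 0 < d i 0) ->
  box x0 d `<=` U -> C2_on U f ->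
  (forall N : 'I_n -> nat, (forall i, (2 <= N i)%N) ->
     forall i k, 0 <= Theta N i k <= 1) ->
  exists2 v : 'cV[R]_n,
    (fun N => gsg f x0 (sample_mx d (Theta N))) @ all_infty n --> v &
    \sum_i (d i 0 * (v - grad f x0) i 0) ^+ 2 / 12
      <= (lipschitz_const (box x0 d) (grad f) / 2 * enorm d ^+ 2) ^+ 2.
Proof.
move=> n0 d0 bU fC2 Th01.
set L := lipschitz_const _ _; set rho := L / 2 * enorm d ^+ 2.
set S := fun N : 'I_n -> nat => sample_mx d (Theta N).
have L0 : 0 <= L by exact: lipschitz_const_ge0.
have df x : box x0 d x -> differentiable f x by move=> /bU /fC2 [].
have gL x y : box x0 d x -> box x0 d y ->
    enorm (grad f x - grad f y) <= L * enorm (x - y).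
  exact: C2_grad_lipschitz fC2.
have [B B0 dB] : exists2 B : R, 0 <= B & forall x, box x0 d x -> `|grad f x| <= B.
  apply: bounded_on_box => x /bU /fC2 [_ dg _].
  exact: differentiable_continuous.
have {}dB x i : box x0 d x -> `|grad f x i 0| <= B.
  by move=> /dB; apply: le_trans; exact: entry_le_norm.
pose A i j N := avg (fun k => S N i k * S N j k).
pose b i N := avg (fun k => S N i k * (f (x0 + col k (S N)) - f x0)).
pose M i j := d i 0 * d j 0 * (4^-1 + (i == j)%:R / 12).
have AM i j : A i j @ all_infty n --> M i j by exact: second_moment_cvg.
have bcvg i : cvg (b i @ all_infty n).
  pose H (u : 'cV[R]_n) := u i 0 * (f (x0 + u) - f x0).
  have -> : b i = (fun N => avg (fun k => H (col k (S N)))).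
    apply/funext => N; rewrite /b; congr avg; apply/funext => k.
    by rewrite /H [col _ _ _ _]mxE.
  apply: (@sample_avg_cvg _ _ _ _ (2 * B * \sum_j d j 0)) => //.
    by rewrite !mulr_ge0 // sumr_ge0 // => j _; exact: ltW.
  by move=> u v ub vb; exact: first_moment_lipschitz.
have [m mE dm] := min_entryP d n0.
pose c := d m 0 ^+ 2 / 12; have c0 : 0 < c by rewrite divr_gt0 ?exprn_gt0.
have low (v : 'cV[R]_n) : \sum_i (d i 0 * v i 0) ^+ 2 / 12
    <= \sum_i \sum_j v i 0 * M i j * v j 0.
  by rewrite uniform_moment_form -mulr_suml lerDr divr_ge0 ?sqr_ge0.
have coer (v : 'cV[R]_n) :
    c * enorm v ^+ 2 <= \sum_i \sum_j v i 0 * M i j * v j 0.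
  apply: le_trans (low v); rewrite enorm_sqr mulr_sumr; apply: ler_sum => i _.
  rewrite /c mulrAC -exprMn ler_wpM2r ?invr_ge0 // !exprMn ler_wpM2r ?sqr_ge0 //.
  by rewrite ler_sqr ?nnegrE ?dm // ltW.
have [v vE] := coercive_solvable (fun i => lim (b i @ all_infty n)) c0 coer.
have bM i : b i @ all_infty n --> \sum_j M i j * v j 0 by rewrite vE; exact: bcvg.
exists v.
  apply: (cvg_coercive_system (A := A) (b := b) (A0 := M) _ _ AM bM c0 coer).
  by exists 0%N => N _ i; exact: avg_normal_equation.
set e := v - grad f x0; apply: le_trans (low e) _.
have Mg i : \sum_j A i j N * grad f x0 j 0 @[N --> all_infty n]
    --> \sum_j M i j * grad f x0 j 0.
  by apply: cvg_sum_ord => j; apply: cvgMr_tmp.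
have lhs : \sum_i e i 0 * (b i N - \sum_j A i j N * grad f x0 j 0) @[N --> all_infty n]
    --> \sum_i \sum_j e i 0 * M i j * e j 0.
  have -> : \sum_i \sum_j e i 0 * M i j * e j 0
      = \sum_i e i 0 * (\sum_j M i j * v j 0 - \sum_j M i j * grad f x0 j 0).
    apply: eq_bigr => i _; rewrite -sumrB mulr_sumr; apply: eq_bigr => j _.
    by rewrite !mxE; ring.
  by apply: cvg_sum_ord => i; apply: cvgMl_tmp; apply: cvgB.
have rhs : (\sum_i \sum_j e i 0 * A i j N * e j 0) / 2 + rho ^+ 2 / 2 @[N --> all_infty n]
    --> (\sum_i \sum_j e i 0 * M i j * e j 0) / 2 + rho ^+ 2 / 2.
  apply: cvgD; last exact: cvg_cst.
  apply: cvgMr_tmp; apply: cvg_sum_ord => i; apply: cvg_sum_ord => j.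
  by apply: cvgMr_tmp; apply: cvgMl_tmp.
suff : \sum_i \sum_j e i 0 * M i j * e j 0
    <= (\sum_i \sum_j e i 0 * M i j * e j 0) / 2 + rho ^+ 2 / 2 by lra.
rewrite -subr_ge0; apply: (cvgr_to_ge (cvgB rhs lhs)).
exists 2%N => N N2 /=; rewrite subr_ge0; apply: avg_residual_le => k.
have Sb i : 0 <= S N i k <= d i 0.
  apply: sample_in_box => //; first exact: ltn_trans (N2 i).
  exact: Th01.
have ub : box x0 d (x0 + col k (S N)).
  move=> i; rewrite mxE [col _ _ _ _]mxE.
  by have /andP[? ?] := Sb i; rewrite lerDl lerD2l; apply/andP.
have x0b : box x0 d x0 by move=> i; rewrite lexx lerDl ltW.
have -> : \sum_i grad f x0 i 0 * S N i k = \sum_i grad f x0 i 0 * (col k (S N)) i 0.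
  by apply: eq_bigr => i _; rewrite [col _ _ _ _]mxE.
apply: le_trans (taylor_bound df gL x0b ub) _.
rewrite /rho ler_wpM2l ?divr_ge0 // !enorm_sqr; apply: ler_sum => i _.
by rewrite [col _ _ _ _]mxE; have /andP[? ?] := Sb i; rewrite ler_sqr ?nnegrE // ltW.
Qed.

Theorem theorem4p4 (R : realType) (n : nat) (x0 d : 'cV[R]_n)
    (U : set 'cV[R]_n) (f : 'cV[R]_n -> R)
    (Theta : forall N : 'I_n -> nat, 'M[R]_(n, \prod_(i < n) N i)) :
  (2 <= n)%N ->
  (forall i, 0 < d i 0) ->
  open U -> box x0 d `<=` U -> C2_on U f ->
  (forall N : 'I_n -> nat, (forall i, (2 <= N i)%N) ->
     forall i k, 0 <= Theta N i k <= 1) ->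
  let G := fun N : 'I_n -> nat => gsg f x0 (sample_mx d (Theta N)) in
  let L := lipschitz_const (box x0 d) (grad f) in
  [/\ cvg (G @ all_infty n),
      enorm (lim (G @ all_infty n) - grad f x0)
        <= 3 / 2 * Num.sqrt n%:R * L * (enorm d ^+ 2 / min_entry d)
    & (forall i j, d i 0 = d j 0) ->
      enorm (lim (G @ all_infty n) - grad f x0)
        <= 1 / 2 * (2 * n%:R + 1) * L * enorm d].
Proof.
move=> n2 d0 _ bU fC2 Th01 G L.
have n0 : (0 < n)%N by exact: ltn_trans n2.
have [v Gv energy] := gsg_cvg_energy n0 d0 bU fC2 Th01.
have -> : lim (G @ all_infty n) = v by exact: cvg_lim Gv.
have L0 : 0 <= L by exact: lipschitz_const_ge0.
have D0 : 0 <= enorm d by exact: enorm_ge0.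
have [m -> dm] := min_entryP d n0.
set e := v - grad f x0; set D := enorm d in D0 energy *.
have dm0 := d0 m.
(* In squared form |e| <= sqrt 3 L |d|^2 / min d. *)
have e2 : \sum_i e i 0 ^+ 2 <= 3 * (L * D ^+ 2 / d m 0) ^+ 2.
  have -> : 3 * (L * D ^+ 2 / d m 0) ^+ 2
      = 12 * (L / 2 * D ^+ 2) ^+ 2 / d m 0 ^+ 2 by field; rewrite gt_eqF.
  rewrite ler_pdivlMr ?exprn_gt0 // mulr_suml -ler_pdivrMl //.
  apply: le_trans energy; rewrite mulr_sumr; apply: ler_sum => i _.
  rewrite mulrC ler_wpM2r ?invr_ge0 // exprMn mulrC ler_wpM2r ?sqr_ge0 //.
  by rewrite ler_sqr ?nnegrE ?dm // ltW.
have n2' : 2 <= n%:R :> R by rewrite ler_nat.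
split; first exact: Gv.
(* Squared, the two claims reduce to 3 <= 9 n / 4 and 3 n <= (n + 1 / 2)^2, which
   hold for n >= 2. *)
- apply: enorm_le.
    by rewrite !mulr_ge0 ?sqrtr_ge0 ?sqr_ge0 ?invr_ge0 // ltW.
  apply: le_trans e2 _.
  have -> : (3 / 2 * Num.sqrt n%:R * L * (D ^+ 2 / d m 0)) ^+ 2
     = 9 / 4 * Num.sqrt n%:R ^+ 2 * (L * D ^+ 2 / d m 0) ^+ 2.
    by field; rewrite gt_eqF.
  by rewrite sqr_sqrtr // ler_wpM2r ?sqr_ge0 //; lra.
- move=> deq; apply: enorm_le.
    by rewrite !mulr_ge0 ?addr_ge0.
  apply: le_trans e2 _.
  have D2 : D ^+ 2 = n%:R * d m 0 ^+ 2.
    rewrite enorm_sqr (eq_bigr (fun=> d m 0 ^+ 2)) => [|i _]; last by rewrite (deq i m).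
    by rewrite sumr_const card_ord mulr_natl.
  have -> : 3 * (L * D ^+ 2 / d m 0) ^+ 2 = 3 * n%:R * (L * D) ^+ 2.
    rewrite [(L * D) ^+ 2]exprMn D2; field; by rewrite gt_eqF.
  have -> : (1 / 2 * (2 * n%:R + 1) * L * D) ^+ 2
     = (n%:R + 1 / 2) ^+ 2 * (L * D) ^+ 2 by field.
  by rewrite ler_wpM2r ?sqr_ge0 //; nra.
Qed.
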